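(* Let $M\in\mathbb{C}^{p\times p}$ be invertible, let $\mathcal{A}\in\mathbb{C}^{m\times n\times p}$ have multirank $\mathrm{rank}_M(\mathcal{A})=(r,r,\ldots,r)$, and let $\mathcal{W}\in\mathbb{C}^{n\times m\times p}$ with $\mathscr{R}(\mathcal{W})=\mathcal{U}$ and $\mathscr{N}(\mathcal{W})=\mathcal{V}$, where for each $k=1,\ldots,p$ the slice $\tilde{\mathcal{U}}_k=\{\tilde{\mathcal{X}}(:,1,k)\mid\mathcal{X}\in\mathcal{U}\}$ is a subspace of $\mathbb{C}^n$ of dimension $l\le r$ and the slice $\tilde{\mathcal{V}}_k=\{\tilde{\mathcal{X}}(:,1,k)\mid\mathcal{X}\in\mathcal{V}\}$ is a subspace of $\mathbb{C}^m$ of dimension $m-l$ ($l$ independent of $k$). If $\mathcal{W}=\mathcal{S}*_M\mathcal{T}$ is a full-rank decomposition of $\mathcal{W}$ and $\mathcal{A}^{(2)}_{\mathcal{U},\mathcal{V}}$ exists, then (i) $\mathcal{T}*_M\mathcal{A}*_M\mathcal{S}$ is invertible; (ii) $\mathcal{A}^{(2)}_{\mathcal{U},\mathcal{V}}=\mathcal{S}*_M(\mathcal{T}*_M\mathcal{A}*_M\mathcal{S})^{-1}*_M\mathcal{T}=\mathcal{A}^{(2)}_{\mathscr{R}(\mathcal{S}),\mathscr{N}(\mathcal{T})}$.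
   Context: For $\mathcal{A}\in\mathbb{C}^{m\times n\times p}$ and an invertible $M\in\mathbb{C}^{p\times p}$, let $\tilde{\mathcal{A}}=\mathcal{A}\times_3 M$, i.e. $\tilde{\mathcal{A}}(i,j,k)=\sum_{l=1}^p M(k,l)\,\mathcal{A}(i,j,l)$. The $k$-th frontal slice of $\tilde{\mathcal{A}}$ is the matrix $\tilde{\mathcal{A}}(:,:,k)$. M-product: for $\mathcal{A}\in\mathbb{C}^{m\times n\times p}$ and $\mathcal{B}\in\mathbb{C}^{n\times q\times p}$, $\mathcal{A}*_M\mathcal{B}\in\mathbb{C}^{m\times q\times p}$ is the unique tensor $\mathcal{C}$ with $\tilde{\mathcal{C}}(:,:,k)=\tilde{\mathcal{A}}(:,:,k)\tilde{\mathcal{B}}(:,:,k)$ for all $k=1,\ldots,p$. A tensor $\mathcal{A}\in\mathbb{C}^{n\times n\times p}$ is invertible (with respect to $*_M$) if every frontal slice of $\tilde{\mathcal{A}}$ is invertible; then $\widetilde{\mathcal{A}^{-1}}(:,:,k)=(\tilde{\mathcal{A}}(:,:,k))^{-1}$. Multirank: $\mathrm{rank}_M(\mathcal{A})=(r_1,\ldots,r_p)$ with $r_k=\mathrm{rank}(\tilde{\mathcal{A}}(:,:,k))$. Tubal rank: $\mathrm{rank}_t(\mathcal{A})=\max_k r_k$. Full-rank decomposition (FRD): if $\mathcal{W}\in\mathbb{C}^{n\times m\times p}$ has $\mathrm{rank}_t(\mathcal{W})=l$, then $\mathcal{W}=\mathcal{S}*_M\mathcal{T}$ is an FRD of $\mathcal{W}$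 when $\mathcal{S}\in\mathbb{C}^{n\times l\times p}$, $\mathcal{T}\in\mathbb{C}^{l\times m\times p}$ and $\mathrm{rank}_t(\mathcal{S})=l=\mathrm{rank}_t(\mathcal{T})$. Range and null space of $\mathcal{A}\in\mathbb{C}^{m\times n\times p}$: $\mathscr{R}(\mathcal{A})=\{\mathcal{A}*_M\mathcal{X}\mid \mathcal{X}\in\mathbb{C}^{n\times 1\times p}\}$ and $\mathscr{N}(\mathcal{A})=\{\mathcal{X}\in\mathbb{C}^{n\times 1\times p}\mid \mathcal{A}*_M\mathcal{X}=\mathcal{O}\}$. Outer inverse with prescribed range $\mathcal{U}$ and null space $\mathcal{V}$: for $\mathcal{A}\in\mathbb{C}^{m\times n\times p}$, $\mathcal{A}^{(2)}_{\mathcal{U},\mathcal{V}}$ is the (unique, if it exists) tensor $\mathcal{Z}\in\mathbb{C}^{n\times m\times p}$ with $\mathcal{Z}*_M\mathcal{A}*_M\mathcal{Z}=\mathcal{Z}$, $\mathscr{R}(\mathcal{Z})=\mathcal{U}$ and $\mathscr{N}(\mathcal{Z})=\mathcal{V}$. *)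

(* Defs.v *)
From HB Require Import structures.
From mathcomp Require Import all_boot all_order all_algebra.
From mathcomp Require Import all_classical all_reals.
From mathcomp Require Import complex.

Set Implicit Arguments.
Unset Strict Implicit.
Unset Printing Implicit Defensive.

Import GRing.Theory.
Local Open Scope classical_set_scope.
Local Open Scope ring_scope.

(* An m x n x p tensor is stored as the family of its p frontal slices:
   the entry A(i, j, k) is [A k i j]. *)
Notation tensor F m n p := {ffun 'I_p -> 'M[F]_(m, n)}.

(* A x_3 M *)
Definition mode3 (F : fieldType) (m n p : nat) (M : 'M[F]_p)
    (A : tensor F m n p) : tensor F m n p :=
  [ffun k => \matrix_(i, j) \sum_(l < p) M k l * A l i j].

(* The slicewise product (inverse) of the transforms, transformed back by
   M^-1; [mprodP] and [tinvP] below give the characterization through the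
   slices of the transform. *)
Definition mprod (F : fieldType) (m n q p : nat) (M : 'M[F]_p)
    (A : tensor F m n p) (B : tensor F n q p) : tensor F m q p :=
  mode3 (invmx M) [ffun k => mode3 M A k *m mode3 M B k].

Notation "A *_[ M ] B" := (mprod M A B)
  (at level 40, left associativity, format "A  *_[ M ]  B") : ring_scope.

Definition tinvertible (F : fieldType) (n p : nat) (M : 'M[F]_p)
    (A : tensor F n n p) : Prop :=
  forall k, mode3 M A k \in unitmx.

Definition tinv (F : fieldType) (n p : nat) (M : 'M[F]_p)
    (A : tensor F n n p) : tensor F n n p :=
  mode3 (invmx M) [ffun k => invmx (mode3 M A k)].

Definition multirank (F : fieldType) (m n p : nat) (M : 'M[F]_p)
    (A : tensor F m n p) : {ffun 'I_p -> nat} :=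
  [ffun k => \rank (mode3 M A k)].

Definition tubal_rank (F : fieldType) (m n p : nat) (M : 'M[F]_p)
    (A : tensor F m n p) : nat :=
  \max_(k < p) multirank M A k.

Definition full_rank_decomposition (F : fieldType) (n m l p : nat)
    (M : 'M[F]_p) (W : tensor F n m p) (S : tensor F n l p)
    (T : tensor F l m p) : Prop :=
  [/\ tubal_rank M W = l, W = S *_[M] T,
      tubal_rank M S = l & tubal_rank M T = l].

Definition trange (F : fieldType) (m n p : nat) (M : 'M[F]_p)
    (A : tensor F m n p) : set (tensor F m 1 p) :=
  [set A *_[M] X | X in [set: tensor F n 1 p]].

Definition tnull (F : fieldType) (m n p : nat) (M : 'M[F]_p)
    (A : tensor F m n p) : set (tensor F n 1 p) :=
  [set X | A *_[M] X = 0].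

(* { X~(:, 1, k) | X in E }; the frontal slice X~(:, :, k) of an n x 1 x p
   tensor is already a column vector. *)
Definition set_slice (F : fieldType) (n p : nat) (M : 'M[F]_p)
    (E : set (tensor F n 1 p)) (k : 'I_p) : set 'cV[F]_n :=
  [set mode3 M X k | X in E].

Definition subspace_of_dim (F : fieldType) (n : nat) (E : set 'cV[F]_n)
    (d : nat) : Prop :=
  exists2 L : {vspace 'cV[F]_n}, E = [set x | x \in L] & \dim L = d.

Definition outer_inverse (F : fieldType) (m n p : nat) (M : 'M[F]_p)
    (A : tensor F m n p) (U : set (tensor F n 1 p)) (V : set (tensor F m 1 p))
    (Z : tensor F n m p) : Prop :=
  [/\ Z *_[M] A *_[M] Z = Z, trange M Z = U & tnull M Z = V].

(* "Z = A^(2)_{U,V}": Z is the one and only outer inverse of A with range U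
   and null space V. *)
Definition is_A2 (F : fieldType) (m n p : nat) (M : 'M[F]_p)
    (A : tensor F m n p) (U : set (tensor F n 1 p)) (V : set (tensor F m 1 p))
    (Z : tensor F n m p) : Prop :=
  unique (outer_inverse M A U V) Z.

Lemma mode3_mul (F : fieldType) (m n p : nat) (M N : 'M[F]_p)
    (A : tensor F m n p) : mode3 M (mode3 N A) = mode3 (M *m N) A.
Proof.
apply/ffunP=> k; apply/matrixP=> i j; rewrite !ffunE !mxE.
under eq_bigr do rewrite ffunE mxE mulr_sumr.
rewrite exchange_big /=; apply: eq_bigr => l _.
by rewrite mxE mulr_suml; apply: eq_bigr => h _; rewrite mulrA.
Qed.

Lemma mode3_1 (F : fieldType) (m n p : nat) (A : tensor F m n p) :
  mode3 1%:M A = A.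
Proof.
apply/ffunP=> k; apply/matrixP=> i j; rewrite !ffunE !mxE (bigD1 k) //=.
rewrite mxE eqxx mul1r big1 ?addr0 // => l /negPf lk.
by rewrite mxE eq_sym lk mul0r.
Qed.

Lemma mode3K (F : fieldType) (m n p : nat) (M : 'M[F]_p) :
  M \in unitmx -> cancel (@mode3 F m n p M) (mode3 (invmx M)).
Proof. by move=> Mu A; rewrite mode3_mul mulVmx // mode3_1. Qed.

Lemma mode3VK (F : fieldType) (m n p : nat) (M : 'M[F]_p) :
  M \in unitmx -> cancel (@mode3 F m n p (invmx M)) (mode3 M).
Proof. by move=> Mu A; rewrite mode3_mul mulmxV // mode3_1. Qed.

Lemma mprodP (F : fieldType) (m n q p : nat) (M : 'M[F]_p)
    (A : tensor F m n p) (B : tensor F n q p) (C : tensor F m q p) :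
  M \in unitmx ->
  C = A *_[M] B <-> forall k, mode3 M C k = mode3 M A k *m mode3 M B k.
Proof.
move=> Mu; split=> [-> k|CE]; first by rewrite /mprod mode3VK // ffunE.
apply: (can_inj (mode3K Mu)); rewrite /mprod mode3VK //.
by apply/ffunP=> k; rewrite CE [RHS]ffunE.
Qed.

Lemma tinvP (F : fieldType) (n p : nat) (M : 'M[F]_p)
    (A B : tensor F n n p) :
  M \in unitmx ->
  B = tinv M A <-> forall k, mode3 M B k = invmx (mode3 M A k).
Proof.
move=> Mu; split=> [-> k|BE]; first by rewrite /tinv mode3VK // ffunE.
apply: (can_inj (mode3K Mu)); rewrite /tinv mode3VK //.
by apply/ffunP=> k; rewrite BE [RHS]ffunE.
Qed.

(* Main.v *)
Require Import Defs.
From mathcomp Require Import all_boot all_order all_algebra.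
From mathcomp Require Import all_classical all_reals.
From mathcomp Require Import complex.

(** The transform [mode3 M] turns the M-product into the slicewise matrix
    product, so everything reduces to a statement about each triple of slices.

    Ranges and null spaces are converted into row-space inclusions of slices
    ([trange_subP], [tnull_subP]): inclusion of column spaces is divisibility
    on the left, inclusion of kernels is divisibility on the right.  The slices
    of the range of [W] have dimension [l], hence each slice of [W] has rank [l]
    ([rank_slice_trange]), and the factorization [W = S T] through dimension [l]
    forces each slice of [S] to be left invertible and each slice of [T] to be
    right invertible ([rank_factorization]).  Consequently [S] has the range of
    [W] and [T] has its null space.

    The heart of the proof is [outer_inverse_mx].  Let [Z] be an outer inverse
    of [A] with the column space of [S] and the kernel of [T], and write
    [S = Z Q] and [Z = P T].  Then [S = Z Q = Z A Z Q = Z A S = P (T A S)].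
    Cancelling [S] on the left shows that the square matrix [T A S] is left
    invertible, hence invertible; therefore [P = S (T A S)^-1] and
    [Z = P T = S (T A S)^-1 T].  As the right-hand side does not mention [Z],
    this formula also gives uniqueness, so the assumed existence of some outer
    inverse yields the whole theorem. *)

Import GRing.Theory.
Local Open Scope classical_set_scope.
Local Open Scope ring_scope.
Local Open Scope complex_scope.

(** * Matrix facts *)

(** Testing the kernel condition on the columns of [cokermx B], which span the
    kernel of [B], is enough. *)
Lemma ker_submx {F : fieldType} {m1 m2 n : nat}
    (A : 'M[F]_(m1, n)) (B : 'M[F]_(m2, n)) :
  (forall x : 'cV[F]_n, B *m x = 0 -> A *m x = 0) <-> (A <= B)%MS.
Proof.
split=> [kerBA | /submxP[D ->] x Bx0]; last by rewrite -mulmxA Bx0 mulmx0.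
rewrite submxE; apply/eqP/matrixP=> i j.
have /kerBA/matrixP/(_ i 0) : B *m col j (cokermx B) = 0.
  by rewrite colE mulmxA mulmx_coker mul0mx.
by rewrite colE mulmxA -colE [in LHS]mxE => ->; rewrite !mxE.
Qed.

Lemma col_submx {F : fieldType} {m n1 n2 : nat}
    (A : 'M[F]_(m, n1)) (B : 'M[F]_(m, n2)) :
  (forall x : 'cV[F]_n1, exists y : 'cV[F]_n2, A *m x = B *m y) <->
  (A^T <= B^T)%MS.
Proof.
split=> [AB | /submxP[D DE] x].
  apply/row_subP=> j; have [y yE] := AB (delta_mx j 0).
  by rewrite -tr_col colE yE trmx_mul submxMl.
by exists (D^T *m x); rewrite mulmxA; congr (_ *m _); rewrite -[A]trmxK DE
  trmx_mul trmxK.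
Qed.

(** Restricting to a basis of the column space makes the map
    [x |-> A *m x] injective, so its image has the dimension of its source. *)
Lemma dim_col_space {F : fieldType} {m n : nat} (A : 'M[F]_(m, n))
    (L : {vspace 'cV[F]_m}) :
  (forall y, y \in L <-> exists x : 'cV[F]_n, y = A *m x) ->
  \dim L = \rank A.
Proof.
move=> LE; pose f := linfun (mulmx (col_base A) : 'cV_(\rank A) -> 'cV_m).
have fE x : f x = col_base A *m x by rewrite lfunE.
have inj_f : (fullv :&: lker f = 0)%VS.
  apply/eqP; rewrite -subv0; apply/subvP=> x; rewrite memv_cap memv_ker fE.
  move=> /andP[_ /eqP cx0]; rewrite memv0; apply/eqP.
  have /row_fullP[C CE] := col_base_full A.
  by rewrite -[x]mul1mx -CE -mulmxA cx0 mulmx0.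
have -> : L = (f @: fullv)%VS.
  apply/vspaceP=> y; apply/idP/idP.
    move=> /LE[x ->]; rewrite -{1}(mulmx_base A) -mulmxA -fE.
    exact/memv_img/memvf.
  move=> /memv_imgP[x _ ->]; apply/LE; rewrite fE.
  have /row_freeP[C CE] := row_base_free A.
  by exists (C *m x); rewrite -[x in LHS]mul1mx -CE -(mulmxA (row_base A))
    (mulmxA (col_base A)) mulmx_base.
by rewrite limg_dim_eq // dimvf /dim /= muln1.
Qed.

Lemma rank_factorization {F : fieldType} {n m l : nat} (S : 'M[F]_(n, l))
    (T : 'M[F]_(l, m)) :
  \rank (S *m T) = l -> row_full S /\ row_free T.
Proof.
move=> rST; split.
  by rewrite /row_full eqn_leq rank_leq_col -{1}rST mxrankM_maxl.
by rewrite /row_free eqn_leq rank_leq_row -{1}rST mxrankM_maxr.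
Qed.

(** With [S = Z *m Q] and [Z = P *m T], the outer inverse equation gives
    [S = P *m (T *m A *m S)]; full column rank of [S] then inverts
    [T *m A *m S] and determines [P]. *)
Lemma outer_inverse_mx {F : fieldType} {m n l : nat} {A : 'M[F]_(m, n)}
    {Z : 'M[F]_(n, m)} {S : 'M[F]_(n, l)} {T : 'M[F]_(l, m)} :
  Z *m A *m Z = Z -> (S^T <= Z^T)%MS -> (Z <= T)%MS -> row_full S ->
  T *m A *m S \in unitmx /\ Z = S *m invmx (T *m A *m S) *m T.
Proof.
move=> ZAZ /submxP[Q QE] /submxP[P PE] /row_fullP[L LS].
have SE : S = Z *m Q^T by rewrite -[S]trmxK QE trmx_mul trmxK.
have SP : S = P *m (T *m A *m S).
  by rewrite !mulmxA -PE {2}SE mulmxA ZAZ.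
have TASu : T *m A *m S \in unitmx.
  have /mulmx1_unit[] // : L *m P *m (T *m A *m S) = 1%:M.
  by rewrite -(mulmxA L) -SP.
by split=> //; rewrite {1}SP mulmxK.
Qed.

(** * Ranges and null spaces of tensors, slice by slice *)

Lemma mode3_mprod {F : fieldType} {m n q p : nat} {M : 'M[F]_p}
    (A : tensor F m n p) (B : tensor F n q p) (k : 'I_p) :
  M \in unitmx -> mode3 M (A *_[M] B) k = mode3 M A k *m mode3 M B k.
Proof. by move=> Mu; have [/(_ erefl)] := mprodP A B (A *_[M] B) Mu. Qed.

Lemma mode3_tinv {F : fieldType} {n p : nat} {M : 'M[F]_p}
    (A : tensor F n n p) (k : 'I_p) :
  M \in unitmx -> mode3 M (tinv M A) k = invmx (mode3 M A k).
Proof. by move=> Mu; have [/(_ erefl)] := tinvP A (tinv M A) Mu. Qed.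

Lemma eq_mode3 {F : fieldType} {m n p : nat} {M : 'M[F]_p}
    (A B : tensor F m n p) :
  M \in unitmx -> (forall k, mode3 M A k = mode3 M B k) -> A = B.
Proof.
by move=> Mu AB; apply: (can_inj (mode3K (M := M) Mu)); apply/ffunP.
Qed.

Lemma mode3_0 {F : fieldType} {m n p : nat} (M : 'M[F]_p) (k : 'I_p) :
  mode3 M (0 : tensor F m n p) k = 0.
Proof.
apply/matrixP=> i j; rewrite ffunE !mxE big1 // => h _.
by rewrite ffunE mxE mulr0.
Qed.

(** Because the transform is onto, slices can be prescribed independently. *)
Lemma mode3_lift {F : fieldType} {m n p : nat} {M : 'M[F]_p}
    (x : 'I_p -> 'M[F]_(m, n)) :
  M \in unitmx -> exists X : tensor F m n p, forall k, mode3 M X k = x k.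
Proof.
move=> Mu; exists (mode3 (invmx M) [ffun k => x k]) => k.
by rewrite mode3VK // ffunE.
Qed.

Lemma trange_subP {F : fieldType} {m n q p : nat} {M : 'M[F]_p}
    (A : tensor F m n p) (B : tensor F m q p) :
  M \in unitmx ->
  trange M A `<=` trange M B <->
  forall k, ((mode3 M A k)^T <= (mode3 M B k)^T)%MS.
Proof.
move=> Mu; split=> [AB k | AB _ [X _ <-]].
  apply/col_submx=> x; have [X XE] := mode3_lift (fun=> x) Mu.
  have [|Y _ YE] := AB (A *_[M] X); first by exists X.
  by exists (mode3 M Y k); rewrite -(XE k) -!mode3_mprod // YE.
have /choice[y yE] k := (col_submx _ _).2 (AB k) (mode3 M X k).
have [Y YE] := mode3_lift y Mu.
by exists Y => //; apply: (eq_mode3 _ _ Mu) => k; rewrite !mode3_mprod // YE yE.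
Qed.

Lemma tnull_subP {F : fieldType} {m1 m2 n p : nat} {M : 'M[F]_p}
    (A : tensor F m1 n p) (B : tensor F m2 n p) :
  M \in unitmx ->
  tnull M B `<=` tnull M A <->
  forall k, (mode3 M A k <= mode3 M B k)%MS.
Proof.
move=> Mu; split=> [BA k | AB X /= BX0].
  apply/ker_submx=> x Bx0.
  (* the other slices are set to zero, since only [B_k] is known to kill [x] *)
  have [X XE] := mode3_lift (fun h => if h == k then x else 0) Mu.
  have /BA/(congr1 (fun Y => mode3 M Y k)) : tnull M B X.
    apply: (eq_mode3 _ _ Mu) => h; rewrite mode3_mprod // XE mode3_0.
    by case: eqP => [->|_]; rewrite ?mulmx0.
  by rewrite mode3_mprod // XE eqxx mode3_0.
apply: (eq_mode3 _ _ Mu) => k; rewrite mode3_mprod // mode3_0.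
by apply: ((ker_submx _ _).2 (AB k)); rewrite -mode3_mprod // BX0 mode3_0.
Qed.

Lemma rank_slice_trange {F : fieldType} {m n p d : nat} {M : 'M[F]_p}
    (A : tensor F m n p) (k : 'I_p) :
  M \in unitmx -> subspace_of_dim (set_slice M (trange M A) k) d ->
  \rank (mode3 M A k) = d.
Proof.
move=> Mu [L LE <-]; apply/esym/dim_col_space=> y.
have -> : (y \in L) <-> set_slice M (trange M A) k y by rewrite LE.
split=> [[_ [X _ <-] <-] | [x ->]].
  by exists (mode3 M X k); rewrite mode3_mprod.
have [X XE] := mode3_lift (fun=> x) Mu.
by exists (A *_[M] X); [exists X | rewrite mode3_mprod // XE].
Qed.

(** * Outer inverses from a full-rank decomposition *)

(** A right inverse of each slice of [T] writes [S] as a right multiple of the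
    product, so no part of its range is lost. *)
Lemma trange_mprod {F : fieldType} {n l m p : nat} {M : 'M[F]_p}
    (S : tensor F n l p) (T : tensor F l m p) :
  M \in unitmx -> (forall k, row_free (mode3 M T k)) ->
  trange M (S *_[M] T) = trange M S.
Proof.
move=> Mu Tfree; apply/seteqP; split; apply/(trange_subP _ _ Mu) => k;
  rewrite mode3_mprod // trmx_mul; first exact: submxMl.
have /row_freeP[C TC] := Tfree k.
by rewrite -{1}[mode3 M S k]mulmx1 -TC mulmxA !trmx_mul submxMl.
Qed.

(** Dually, a left inverse of each slice of [S] recovers [T] from the product. *)
Lemma tnull_mprod {F : fieldType} {n l m p : nat} {M : 'M[F]_p}
    (S : tensor F n l p) (T : tensor F l m p) :
  M \in unitmx -> (forall k, row_full (mode3 M S k)) ->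
  tnull M (S *_[M] T) = tnull M T.
Proof.
move=> Mu Sfull; apply/seteqP; split; apply/(tnull_subP _ _ Mu) => k;
  rewrite mode3_mprod //; last exact: submxMl.
have /row_fullP[C CS] := Sfull k.
by rewrite -{1}[mode3 M T k]mul1mx -CS -mulmxA submxMl.
Qed.

Lemma outer_inverse_formula {F : fieldType} {m n l p : nat} {M : 'M[F]_p}
    {A : tensor F m n p} {S : tensor F n l p} {T : tensor F l m p}
    {Z : tensor F n m p} :
  M \in unitmx -> (forall k, row_full (mode3 M S k)) ->
  outer_inverse M A (trange M S) (tnull M T) Z ->
  tinvertible M (T *_[M] A *_[M] S) /\
  Z = S *_[M] tinv M (T *_[M] A *_[M] S) *_[M] T.
Proof.
move=> Mu Sfull [ZAZ rZ nZ].
have slices k : mode3 M T k *m mode3 M A k *m mode3 M S k \in unitmx /\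
    mode3 M Z k = mode3 M S k *m
      invmx (mode3 M T k *m mode3 M A k *m mode3 M S k) *m mode3 M T k.
  apply: outer_inverse_mx (Sfull k).
  - by rewrite -!mode3_mprod // ZAZ.
  - by apply: (trange_subP _ _ Mu).1; rewrite rZ.
  - by apply: (tnull_subP _ _ Mu).1; rewrite nZ.
split=> [k|]; first by rewrite !mode3_mprod //; case: (slices k).
apply: (eq_mode3 _ _ Mu) => k; rewrite !mode3_mprod // mode3_tinv //.
by rewrite !mode3_mprod //; case: (slices k).
Qed.

Theorem theorem2p11 (R : realType) (m n p r l : nat) (M : 'M[R[i]]_p)
    (A : tensor R[i] m n p) (W : tensor R[i] n m p)
    (U : set (tensor R[i] n 1 p)) (V : set (tensor R[i] m 1 p))
    (S : tensor R[i] n l p) (T : tensor R[i] l m p)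
    (M_unit : M \in unitmx)
    (A_multirank : multirank M A = [ffun=> r])
    (W_range : trange M W = U) (W_null : tnull M W = V)
    (l_le_r : (l <= r)%N)
    (U_slices : forall k : 'I_p, subspace_of_dim (set_slice M U k) l)
    (V_slices : forall k : 'I_p, subspace_of_dim (set_slice M V k) (m - l))
    (W_frd : full_rank_decomposition M W S T)
    (A2_exists : exists Z, outer_inverse M A U V Z) :
  tinvertible M (T *_[M] A *_[M] S) /\
  (let Z := S *_[M] tinv M (T *_[M] A *_[M] S) *_[M] T in
   is_A2 M A U V Z /\ is_A2 M A (trange M S) (tnull M T) Z).
Proof.
have [_ WE _ _] := W_frd.
have ST_full k : row_full (mode3 M S k) /\ row_free (mode3 M T k).
  apply: rank_factorization; rewrite -mode3_mprod // -WE.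
  by apply: rank_slice_trange; rewrite ?W_range.
have US : U = trange M S.
  by rewrite -W_range WE trange_mprod // => k; case: (ST_full k).
have VT : V = tnull M T.
  by rewrite -W_null WE tnull_mprod // => k; case: (ST_full k).
have formula Z := @outer_inverse_formula _ _ _ _ _ M A S T Z M_unit
  (fun k => (ST_full k).1).
rewrite US VT in A2_exists *; have [Z0 Z0_outer] := A2_exists.
have [TASu Z0E] := formula _ Z0_outer; split=> // Z.
have ZA2 : is_A2 M A (trange M S) (tnull M T) Z.
  by split=> [|Y /formula[_ ->] //]; rewrite /Z -Z0E.
by split.
Qed.
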